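(* Let $F$ be a formula over $L$ and let $\sigma,\theta$ be finite substitutions. (a) If $\sigma\preceq\theta$, then $(\forall)F\sigma\rightarrow(\forall)F\theta$ is valid. (b) If $\sigma\approx\theta$, then $(\forall)F\sigma\leftrightarrow(\forall)F\theta$ is valid. (c) If $\sigma'$ is the restriction of $\sigma$ onto $\mathrm{vars}(F)$, then $(\forall)F\sigma\leftrightarrow(\forall)F\sigma'$ is valid.
   Context: $L$ is a first-order language with equality; variables form a fixed enumerated denumerable set $\mathit{Var}$. $(\forall)G$ is the universal closure of $G$; $\mathrm{vars}(G)$ is the set of free variables of $G$; $G_x[t]$ replaces the free occurrences of $x$ in $G$ by $t$; valid means true in every interpretation under every valuation. A finite substitution $\sigma=\{x_1/s_1,\dots,x_n/s_n\}$ maps a finite set $\mathrm{Dom}(\sigma)$ of variables to terms; $\mathrm{Range}(\sigma)$ is the set of variables occurring in the $s_i$; $t\sigma$ is simultaneous replacement; $(\sigma\tau)(x)=\sigma(x)\tau$ (when $\mathrm{Range}(\sigma)\subseteq\mathrm{Dom}(\tau)$); $\sigma|_X$ is the restriction to $\mathrm{Dom}(\sigma)\cap X$; $\theta$ is a regular extension of $\sigma$ if it extends $\sigma$ and maps $\mathrm{Dom}(\theta)\setminus\mathrm{Dom}(\sigma)$ injectively into variables not in $\mathrm{Range}(\sigma)$. $\sigma\preceq\theta$ iff $\sigma'=\theta'\tau$ for some $\tau$ and some regular extensions $\sigma',\theta'$ of $\sigma,\theta$ with equal domains; $\sigma\approx\theta$ iff $\sigma\preceq\theta$ and $\theta\preceq\sigma$.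 Application $F\sigma$: first, if $\mathrm{Dom}(\sigma)=\mathrm{vars}(F)$, define by structural induction: for an atom or equation apply $\sigma$ to the argument terms; $(\neg G)\sigma=\neg(G\sigma)$; $(G\,b\,H)\sigma=G\sigma_1\,b\,H\sigma_2$ for binary connectives $b$, with $\sigma_1=\sigma|_{\mathrm{vars}(G)}$, $\sigma_2=\sigma|_{\mathrm{vars}(H)}$; for $F=(\exists x)G$: if $x\notin\mathrm{Range}(\sigma)$, $F\sigma=(\exists x)(G\sigma')$ with $\sigma'=\sigma\cup\{x/x\}$ if $x\in\mathrm{vars}(G)$ and $\sigma'=\sigma$ otherwise; if $x\in\mathrm{Range}(\sigma)$, let $y$ be the first variable of $\mathit{Var}$ not in $\mathrm{Range}(\sigma)$ and $F\sigma=(\exists y)(G_x[y]\sigma')$ with $\sigma'=\sigma\cup\{y/y\}$ if $x\in\mathrm{vars}(G)$ and $\sigma'=\sigma$ otherwise; $(\forall x)G$ analogously. For arbitrary $\sigma$: let $\sigma'=\sigma|_{\mathrm{vars}(F)}$ and build $\sigma''$ from $\sigma'$ by repeatedly taking the first variable $x$ of $\mathrm{vars}(F)\setminus\mathrm{Dom}(\sigma'')$ and adding $x/y$ where $y=x$ if $x\notin\mathrm{Range}(\sigma'')$ and otherwise $y$ is the first variable not in $\mathrm{Range}(\sigma'')$; set $F\sigma:=F\sigma''$.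
   Formalization: (a) is proved as (∀)Fθ→(∀)Fσ: as printed it fails for F=p(x), σ={x/c}, θ={x/x}. In the renaming clause of Fσ, G_x[y](σ∪{y/y}) is read as G(σ∪{x/y}), since the literal form is ill-defined if y∈Dom(σ) and captures variables if y is not substitutable for x in G. *)

(* Defs.v *)
From HB Require Import structures.
From mathcomp Require Import all_boot finmap.

Set Implicit Arguments.
Unset Strict Implicit.
Unset Printing Implicit Defensive.

Local Open Scope fset_scope.
Local Open Scope fmap_scope.

(* Variables are natural numbers, enumerated in their usual order, so the     *)
(* "first" variable with a property is the least one.                         *)
Definition var : Type := nat.

Lemma ex_fresh (A : {fset nat}) : exists y, y \notin A.
Proof.
exists (\max_(i <- A) i).+1; apply/negP => yA.
have := @leq_bigmax_seq _ (enum_fset A) xpredT (fun i => i) _ yA isT.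
by rewrite ltnn.
Qed.

Definition fresh (A : {fset nat}) : var := ex_minn (ex_fresh A).

Record language : Type := Language {
  fsym : Type;
  farity : fsym -> nat;
  psym : Type;
  parity : psym -> nat
}.

Section Syntax.
Variable L : language.

Inductive term : Type :=
| Var of var
| Fun (f : fsym L) of {ffun 'I_(farity f) -> term}.

Inductive connective : Type := And | Or | Imp | Iff.
Inductive quantifier : Type := Ex | All.

Inductive formula : Type :=
| Atom (P : psym L) of {ffun 'I_(parity P) -> term}
| Equal of term & term
| Not of formula
| Bin of connective & formula & formula
| Quant of quantifier & var & formula.

Fixpoint tvars (t : term) : {fset nat} :=
  match t with
  | Var x => [fset x]
  | Fun f ts => \big[fsetU/fset0]_(i : 'I_(farity f)) tvars (ts i)
  end.

Fixpoint fvars (F : formula) : {fset nat} :=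
  match F with
  | Atom P ts => \big[fsetU/fset0]_(i : 'I_(parity P)) tvars (ts i)
  | Equal s t => tvars s `|` tvars t
  | Not G => fvars G
  | Bin _ G H => fvars G `|` fvars H
  | Quant _ x G => fvars G `\ x
  end.

(* [sort leq] fixes the order of the quantifier prefix. *)
Definition univ_closure (F : formula) : formula :=
  foldr (Quant All) F (sort leq (fvars F)).

(* Bindings x/x are kept, so that {x/x} and the empty substitution differ.    *)
(* Equality of finite maps is extensional.                                    *)
Definition subst : Type := {fmap nat -> term}.

Definition range (s : subst) : {fset nat} :=
  \big[fsetU/fset0]_(x : domf s) tvars (s x).

Fixpoint tapp (t : term) (s : subst) : term :=
  match t with
  | Var x => odflt (Var x) s.[? x]
  | Fun f ts => Fun [ffun i => tapp (ts i) s]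
  end.

(* Meaningful when [range s `<=` domf t]. *)
Definition scomp (s t : subst) : subst := [fmap x : domf s => tapp (s x) t].

Definition regular_extension (s th : subst) : Prop :=
  [/\ domf s `<=` domf th,
      {in domf s, forall x, th.[? x] = s.[? x]} &
      exists r : var -> var,
        {in domf th `\` domf s &, injective r} /\
        {in domf th `\` domf s, forall x,
           th.[? x] = Some (Var (r x)) /\ r x \notin range s}].

(* [s] is an instance of [th], up to regular extensions. *)
Definition less_general (s th : subst) : Prop :=
  exists s' th' t : subst,
    [/\ regular_extension s s', regular_extension th th',
        domf s' = domf th', range th' `<=` domf t & s' = scomp th' t].

Definition equigeneral (s th : subst) : Prop :=
  less_general s th /\ less_general th s.

(* Application in the case domf s = fvars F; this invariant is preserved by   *)
(* the recursive calls. When x is in [range s], the textbook clause           *)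
(* (Qx)G s = (Qy)(G_x[y] (s U {y/y})) supposes that y is substitutable for x  *)
(* in G and that y is not in domf s (otherwise s U {y/y} is not a function).  *)
(* The renaming of x to y is here merged into the substitution, G (s U {x/y}),*)
(* which is the same formula under these provisos, needs no proviso, and      *)
(* keeps the recursion structural.                                            *)
Fixpoint fapp_exact (F : formula) (s : subst) : formula :=
  match F with
  | Atom P ts => Atom [ffun i => tapp (ts i) s]
  | Equal t u => Equal (tapp t s) (tapp u s)
  | Not G => Not (fapp_exact G s)
  | Bin b G H => Bin b (fapp_exact G s.[& fvars G]) (fapp_exact H s.[& fvars H])
  | Quant q x G =>
      let y := if x \in range s then fresh (range s) else x in
      Quant q y (fapp_exact G (if x \in fvars G then s.[x <- Var y] else s))
  end.

Definition add_var (s : subst) (x : var) : subst :=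
  if x \in domf s then s
  else s.[x <- Var (if x \in range s then fresh (range s) else x)].

Definition complete (F : formula) (s : subst) : subst :=
  foldl add_var s.[& fvars F] (sort leq (fvars F)).

Definition fapp (F : formula) (s : subst) : formula :=
  fapp_exact F (complete F s).

End Syntax.

Record interpretation (L : language) : Type := Interpretation {
  carrier : Type;
  point : carrier;
  ifun (f : fsym L) : {ffun 'I_(farity f) -> carrier} -> carrier;
  ipred (P : psym L) : {ffun 'I_(parity P) -> carrier} -> Prop
}.

Section Semantics.
Variables (L : language) (I : interpretation L).

Definition valuation : Type := var -> carrier I.

Definition update (v : valuation) (x : var) (d : carrier I) : valuation :=
  fun y => if y == x then d else v y.

Fixpoint eval (v : valuation) (t : term L) : carrier I :=
  match t with
  | Var x => v x
  | Fun f ts => ifun [ffun i => eval v (ts i)]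
  end.

Fixpoint sat (v : valuation) (F : formula L) : Prop :=
  match F with
  | Atom P ts => ipred [ffun i => eval v (ts i)]
  | Equal s t => eval v s = eval v t
  | Not G => ~ sat v G
  | Bin And G H => sat v G /\ sat v H
  | Bin Or G H => sat v G \/ sat v H
  | Bin Imp G H => sat v G -> sat v H
  | Bin Iff G H => sat v G <-> sat v H
  | Quant Ex x G => exists d, sat (update v x d) G
  | Quant All x G => forall d, sat (update v x d) G
  end.

End Semantics.

Definition valid (L : language) (F : formula L) : Prop :=
  forall (I : interpretation L) (v : valuation I), sat v F.

(* Main.v *)
(* Semantically, applying [s] to [F] means evaluating [F] at the valuation      *)
(* [pullback v s], x |-> eval v (s x). As [v] varies, the restrictions of these *)
(* valuations to fvars F run over all [u] that agree with some [pullback v s]   *)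
(* on fvars F `&` domf s, the variables outside [domf s] being unconstrained:   *)
(* the completion sends them to distinct new variables, at which [v] can be     *)
(* redefined. Hence the closure of [fapp F s] says that [F] holds at all such   *)
(* [u], which depends only on the restriction of [s] to [fvars F]; and if [s]   *)
(* is an instance of [th] through [t], every such [u] for [s] is one for [th],  *)
(* by pulling back along [t].                                                   *)
Require Import Defs.
From HB Require Import structures.
From mathcomp Require Import all_boot finmap.

Local Open Scope fset_scope.
Local Open Scope fmap_scope.

(** [solvable u s] says that the equations [u x = eval v (s x)], for [x] in [domf s], have a
    solution [v]. By [sat_univ_closure_fapp], the closure of [fapp F s] says that [F] holds at every
    solvable [u]; this combines the substitution lemma [sat_fapp_exact] with [solvable_complete].
    Solvability is invariant under regular extension ([solvable_regular_extension]) and passes from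
    [scomp s t] to [s] ([solvable_scomp]). So the more general substitution has more solvable
    valuations, and its closure implies that of the instance. *)

Lemma fresh_notin (A : {fset nat}) : fresh A \notin A.
Proof. by rewrite /fresh; case: ex_minnP. Qed.

Lemma in_bigfsetU (I : finType) (A : I -> {fset nat}) (i : I) (x : nat) :
  x \in A i -> x \in \big[fsetU/fset0]_j A j.
Proof. by move=> xAi; rewrite (bigD1 i) //= in_fsetU xAi. Qed.

(* The generated [term_ind] has no induction hypothesis for the arguments. *)
Lemma term_nested_ind (L : language) (P : term L -> Prop) :
  (forall x, P (Var L x)) ->
  (forall f (ts : {ffun 'I_(farity f) -> term L}),
     (forall i, P (ts i)) -> P (Fun ts)) ->
  forall t, P t.
Proof.
move=> PV PF; fix IH 1; case=> [x|f ts]; first exact: PV.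
by apply: PF => i; apply: IH.
Qed.

Section Pullback.
Variables (L : language) (I : interpretation L).
Implicit Types (s th : subst L) (u v w : valuation I) (F : formula L).

Lemma eq_eval {u v} (t : term L) :
  {in tvars t, u =1 v} -> eval u t = eval v t.
Proof.
elim/term_nested_ind: t => [x|f ts IH] uv /=; first by apply: uv; rewrite inE.
congr ifun; apply/ffunP => i; rewrite !ffunE; apply: IH => x xi.
by apply: uv; apply: in_bigfsetU xi.
Qed.

Lemma eq_sat {u v} F : {in fvars F, u =1 v} -> sat u F <-> sat v F.
Proof.
elim: F u v => [P ts|s t|G IH|b G IHG H IHH|q x G IH] u v /= uv.
- suff -> : [ffun i => eval u (ts i)] = [ffun i => eval v (ts i)] by [].
  apply/ffunP => i; rewrite !ffunE; apply: eq_eval => x xi.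
  by apply: uv; apply: in_bigfsetU xi.
- by rewrite !(@eq_eval u v) // => x xt; apply: uv; rewrite in_fsetU xt ?orbT.
- by have := IH _ _ uv; tauto.
- have eG : sat u G <-> sat v G.
    by apply: IHG => x xG; apply: uv; rewrite in_fsetU xG.
  have eH : sat u H <-> sat v H.
    by apply: IHH => x xH; apply: uv; rewrite in_fsetU xH orbT.
  by case: b; tauto.
- have {}IH d : sat (update u x d) G <-> sat (update v x d) G.
    apply: IH => z zG; rewrite /update; case: eqP => // /eqP zx.
    by apply: uv; rewrite in_fsetD1 zx.
  case: q; first by split=> -[d /IH]; exists d.
  by split=> H d; apply/IH.
Qed.

Definition pullback v s : valuation I := fun x => eval v (tapp (Var L x) s).

Lemma eq_pullback v s th x : s.[? x] = th.[? x] -> pullback v s x = pullback v th x.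
Proof. by rewrite /pullback /= => ->. Qed.

Lemma pullback_set v s x (t : term L) z :
  pullback v s.[x <- t] z = if z == x then eval v t else pullback v s z.
Proof.
transitivity (eval v (odflt (Var L z) s.[x <- t].[? z])); first by [].
by rewrite fnd_set; case: eqP.
Qed.

Lemma eval_tapp v s (t : term L) : eval v (tapp t s) = eval (pullback v s) t.
Proof.
elim/term_nested_ind: t => //= f ts IH.
by congr ifun; apply/ffunP => i; rewrite !ffunE.
Qed.

Lemma fnd_in s x : x \in domf s -> exists t, s.[? x] = Some t.
Proof. by move=> xs; rewrite in_fnd; eexists. Qed.

Lemma tvars_range {s x t} : s.[? x] = Some t -> tvars t `<=` range s.
Proof.
move=> sx; have xs : x \in domf s by rewrite -fndSome sx.
apply/fsubsetP => z zt; apply: (@in_bigfsetU _ _ [` xs]).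
by move: sx; rewrite in_fnd => -[->].
Qed.

Lemma eq_pullback_range u v s : {in range s, u =1 v} ->
  {in domf s, pullback u s =1 pullback v s}.
Proof.
move=> uv x /fnd_in[t sx]; rewrite /pullback /= sx.
by apply: eq_eval => z /(fsubsetP (tvars_range sx)); apply: uv.
Qed.

Lemma pullback_update v s y d : y \notin range s ->
  {in domf s, pullback (update v y d) s =1 pullback v s}.
Proof.
move=> ys; apply: eq_pullback_range => z zs; rewrite /update.
by case: eqP ys => // <-; rewrite zs.
Qed.

Lemma pullback_restrict v s (A : {fset nat}) :
  {in A, pullback v s.[& A] =1 pullback v s}.
Proof. by move=> x xA; rewrite /pullback /= fnd_restrict xA. Qed.

(** The domain hypothesis rules out capture: every free variable of a quantified formula is replaced
    by a term over [range s], which the new bound variable avoids. *)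
Lemma sat_fapp_exact F v s :
  domf s = fvars F -> sat v (fapp_exact F s) <-> sat (pullback v s) F.
Proof.
elim: F v s => [P ts|t u|G IH|b G IHG H IHH|q x G IH] v s /= ds.
- suff -> : [ffun i => eval v ([ffun j => tapp (ts j) s] i)] =
            [ffun i => eval (pullback v s) (ts i)] by [].
  by apply/ffunP => i; rewrite !ffunE eval_tapp.
- by rewrite !eval_tapp.
- by have := IH v s ds; tauto.
- have satR K : (forall v s, domf s = fvars K ->
      sat v (fapp_exact K s) <-> sat (pullback v s) K) ->
    fvars K `<=` domf s ->
    sat v (fapp_exact K s.[& fvars K]) <-> sat (pullback v s) K.
    move=> IHK /fsetIidPl Ks; rewrite IHK; last by rewrite domf_restrict.
    by apply: eq_sat; apply: pullback_restrict.
  have := satR G IHG; have := satR H IHH.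
  rewrite ds fsubsetUl fsubsetUr => /(_ isT) eH /(_ isT) eG.
  by case: b; tauto.
- set y := if _ then _ else _; set s1 := if _ then _ else _.
  have ys : y \notin range s.
    by rewrite /y; case: ifPn => // _; apply: fresh_notin.
  have ds1 : domf s1 = fvars G.
    rewrite /s1; case: ifPn => xG; first by rewrite dom_setf ds fsetD1K.
    by rewrite ds mem_fsetD1.
  have {}IH d : sat (update v y d) (fapp_exact G s1) <->
                sat (update (pullback v s) x d) G.
    (* At [x] both valuations give [d], through the binding of [x] to [y]; at the other free
       variables of [G], changing [v] at [y] has no effect. *)
    rewrite IH //; apply: eq_sat => z zG; rewrite [in RHS]/update.
    have [zx|zx] := eqVneq z x.
      by rewrite /s1 -zx zG pullback_set eqxx /= /update eqxx.
    have zs : z \in domf s by rewrite ds in_fsetD1 zx.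
    have <- := pullback_update v s y d ys z zs.
    by rewrite /s1; case: ifP => // _; rewrite pullback_set (negPf zx).
  case: q; first by split=> -[d /IH]; exists d.
  by split=> H d; apply/IH.
Qed.

Lemma sat_foldr_All F v (l : seq nat) :
  sat v (foldr (Quant All) F l) <->
  forall w, (forall x, x \notin l -> w x = v x) -> sat w F.
Proof.
elim: l v => [|x l IH] v /=.
  split=> [sF w wv|]; last exact.
  by have /eq_sat -> : {in fvars F, w =1 v} by move=> x _; apply: wv.
split=> [sF w wv|sF d].
  apply: (proj1 (IH _) (sF (w x))) => z zl; rewrite /update.
  by case: eqVneq => [->//|zx]; apply: wv; rewrite inE negb_or zx.
apply/IH => w wv; apply: sF => z; rewrite inE negb_or => /andP[zx zl].
by rewrite wv // /update (negPf zx).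
Qed.

Lemma sat_univ_closure F v :
  sat v (univ_closure F) <-> forall w, sat w F.
Proof.
rewrite sat_foldr_All; split=> sF w; last by move=> _; apply: sF.
(* Only the free variables are quantified, so [w] is replaced by [v] elsewhere. *)
pose w' x := if x \in fvars F then w x else v x.
have /eq_sat <- : {in fvars F, w' =1 w} by move=> x; rewrite /w' => ->.
by apply: sF => x; rewrite mem_sort /w' => /negPf ->.
Qed.

Definition solvable u s := exists v, {in domf s, u =1 pullback v s}.

(** The new variable is outside [range s], so giving it the value [u x] solves the new equation and
    leaves the old ones intact. *)
Lemma solvable_add_var u s x : solvable u s -> solvable u (add_var s x).
Proof.
rewrite /add_var; case: ifP => // _ [v uv].
set y := if _ then _ else _.
have ys : y \notin range s.
  by rewrite /y; case: ifPn => // _; apply: fresh_notin.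
exists (update v y (u x)) => z; rewrite dom_setf inE pullback_set.
case: eqVneq => [->|zx] /=; first by rewrite /update eqxx.
by rewrite inE (negPf zx) => zs; rewrite uv // -(pullback_update v s y (u x)).
Qed.

Lemma dom_foldl_add_var s (l : seq nat) :
  domf (foldl (@add_var L) s l) =i [predU domf s & l].
Proof.
elim: l s => [|x l IH] s z /=; first by rewrite !inE orbF.
rewrite IH !inE /add_var; case: ifPn => xs.
  by case: eqVneq => // ->; rewrite xs.
by rewrite dom_setf !inE; case: (z == x); rewrite ?orbT.
Qed.

Lemma fnd_foldl_add_var s (l : seq nat) x : x \in domf s ->
  (foldl (@add_var L) s l).[? x] = s.[? x].
Proof.
elim: l s => //= y l IH s xs; rewrite /add_var; case: ifPn => ys; first exact: IH.
rewrite IH ?fnd_set; last by rewrite dom_setf !inE xs orbT.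
by case: eqP xs ys => // ->  ->.
Qed.

Lemma domf_complete F s : domf (complete F s) = fvars F.
Proof.
apply/fsetP => x; rewrite dom_foldl_add_var !inE mem_sort.
by case: (x \in fvars F); rewrite ?andbF ?orbT.
Qed.

Lemma solvable_complete u F s :
  solvable u (complete F s) <-> solvable u s.[& fvars F].
Proof.
rewrite /complete; split.
  move=> [v uv]; exists v => x xs; rewrite uv; last first.
    by rewrite dom_foldl_add_var; apply/orP; left.
  by apply: eq_pullback; rewrite fnd_foldl_add_var.
elim: (sort _ _) s.[& _] => //= x l IH s0 us0.
by apply: IH; apply: solvable_add_var.
Qed.

(** Outside [A] the valuation may be redefined to satisfy the remaining equations of [s], with the
    same solution [v]. *)
Lemma solvable_restrict u s (A : {fset nat}) :
  solvable u s.[& A] -> exists2 w, {in A, u =1 w} & solvable w s.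
Proof.
move=> [v uv]; exists (fun x => if x \in A then u x else pullback v s x).
  by move=> x /= ->.
exists v => x xs; case: ifP => // xA.
by rewrite uv ?pullback_restrict // domf_restrict inE xA.
Qed.

Lemma sat_univ_closure_fapp F s v :
  sat v (univ_closure (fapp F s)) <-> forall u, solvable u s -> sat u F.
Proof.
rewrite sat_univ_closure; split=> [sF u [w uw]|sF w].
  have /solvable_complete[v' uv'] : solvable u s.[& fvars F].
    exists w => x; rewrite domf_restrict inE => /andP[xF xs].
    by rewrite pullback_restrict ?uw.
  move: uv'; rewrite domf_complete => /eq_sat ->.
  by apply/sat_fapp_exact; [rewrite domf_complete | apply: sF].
apply/sat_fapp_exact; first exact: domf_complete.
have /solvable_complete/solvable_restrict[u /eq_sat ->] :
  solvable (pullback w (complete F s)) (complete F s) by exists w.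
exact: sF.
Qed.

(** The added variables go to distinct variables outside [range s], where a solution for [s] can be
    redefined to match [u]. *)
Lemma solvable_regular_extension u s s' : regular_extension s s' ->
  solvable u s <-> solvable u s'.
Proof.
move=> [ss' eqs [r [rinj rfresh]]]; split=> [] [v uv]; last first.
  exists v => x xs; rewrite uv ?(fsubsetP ss') //.
  by apply/eq_pullback/eqs.
pose D := domf s' `\` domf s.
(* The search inverts [r] on [D]; injectivity makes the chosen value unambiguous. *)
pose w z := if [pick x : D | r (val x) == z] is Some x then u (val x) else v z.
have wr x : x \in D -> w (r x) = u x.
  move=> xD; rewrite /w; case: pickP => [y /eqP|/(_ [` xD])]; last by rewrite eqxx.
  by move=> /rinj -> //; apply: valP.
exists w => x xs'; have [xs|xs] := boolP (x \in domf s).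
  have -> : pullback w s' x = pullback w s x by apply/eq_pullback/eqs.
  rewrite uv //; apply: eq_pullback_range (xs) => z zs; rewrite /w.
  case: pickP => // y /eqP yz.
  by have [_] := rfresh _ (valP y); rewrite yz zs.
have xD : x \in D by rewrite in_fsetD xs.
by have [s'x _] := rfresh x xD; rewrite /pullback /= s'x /= wr.
Qed.

(** Pulling [v] back along the composite is pulling it back along [t], then along [s]. *)
Lemma solvable_scomp u s t : solvable u (scomp s t) -> solvable u s.
Proof.
move=> [v uv]; exists (pullback v t) => x xs.
have scompE : (scomp s t).[? x] = Some (tapp s.[xs] t).
  by rewrite (in_fnd (xs : x \in domf (scomp s t))) ffunE.
rewrite uv // /pullback [tapp _ _]/(odflt _ _) scompE /= in_fnd.
exact: eval_tapp.
Qed.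

Lemma less_general_solvable u s th :
  less_general s th -> solvable u s -> solvable u th.
Proof.
move=> [s' [th' [t [/solvable_regular_extension -> /solvable_regular_extension ->]]]].
by move=> _ _ ->; apply: solvable_scomp.
Qed.

End Pullback.

Theorem theorem5p22 (L : language) (F : formula L) (sigma theta : subst L) :
  [/\ less_general sigma theta ->
        valid (Bin Imp (univ_closure (fapp F theta)) (univ_closure (fapp F sigma))),
      equigeneral sigma theta ->
        valid (Bin Iff (univ_closure (fapp F sigma)) (univ_closure (fapp F theta))) &
      forall sigma' : subst L, sigma' = sigma.[& fvars F] ->
        valid (Bin Iff (univ_closure (fapp F sigma)) (univ_closure (fapp F sigma')))].
Proof.
have instance s th : less_general s th ->
    valid (Bin Imp (univ_closure (fapp F th)) (univ_closure (fapp F s))).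
  move=> sth I v /= /sat_univ_closure_fapp thF; apply/sat_univ_closure_fapp.
  by move=> u /(less_general_solvable _ _ _ _ _ sth); apply: thF.
split; first exact: instance.
- by move=> [st ts] I v; split; apply: instance.
- move=> _ -> I v; suff -> : fapp F sigma.[& fvars F] = fapp F sigma by [].
  suff idem : sigma.[& fvars F].[& fvars F] = sigma.[& fvars F].
    by rewrite /fapp /complete idem.
  by apply/fmapP => x; rewrite !fnd_restrict; case: (x \in fvars F).
Qed.
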